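(* Let $(E,d)$ be a metric space, $a<b$ real numbers, $c>0$, and let $f:[a,b]\to E$ be regulated. Then there exists a step function $f^{c}:[a,b]\to E$ such that $\sup_{t\in[a,b]}d(f(t),f^{c}(t))\le c/2$ and, for every $\lambda>1$, $$\mathrm{TV}(f^{c},[a,b])\le\lambda\cdot \mathrm{TV}^{(\lambda-1)c/(2\lambda)}(f,[a,b]).$$ Thus the following estimates hold: $$\mathrm{TV}^{c}(f,[a,b])\le\inf_{g\in B(f,c/2)}\mathrm{TV}(g,[a,b])\le\inf_{\lambda>1}\lambda\cdot \mathrm{TV}^{(\lambda-1)c/(2\lambda)}(f,[a,b]).$$ In particular (taking $\lambda=2$), $$\mathrm{TV}^{c}(f,[a,b])\le\inf_{g\in B(f,c/2)}\mathrm{TV}(g,[a,b])\le 2\cdot \mathrm{TV}^{c/4}(f,[a,b]).$$ Moreover, if $E$ is a normed vector space with norm $\|\cdot\|_{E}$ (and $d$ is the metric induced by the norm), then there exists $f^{c,lin}:[a,b]\to E$ such that $f^{c,lin}$ is piecewise linear, jumps of $f^{c,lin}$ occur only at points where jumps of $f$ occur, $\sup_{t\in[a,b]}\|f(t)-f^{c,lin}(t)\|_{E}\le c$ and $\mathrm{TV}(f^{c,lin},[a,b])=\mathrm{TV}(f^{c},[a,b])$.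
   Context: A function $f:[a,b]\to E$ is regulated if it has right limits $f(t+)\in E$ for every $t\in[a,b)$ and left limits $f(t-)\in E$ for every $t\in(a,b]$. For $g:[a,b]\to E$ and $\delta\ge 0$, the truncated variation is $$\mathrm{TV}^{\delta}(g,[a,b]):=\sup_{n}\ \sup_{a\le t_{0}<t_{1}<\ldots<t_{n}\le b}\ \sum_{i=1}^{n}\max\{d(g(t_{i}),g(t_{i-1}))-\delta,0\},$$ and the total variation is $\mathrm{TV}(g,[a,b]):=\mathrm{TV}^{0}(g,[a,b])$, i.e. the supremum of $\sum_i d(g(t_i),g(t_{i-1}))$. $B(f,c/2)$ denotes the set of all functions $g:[a,b]\to E$ with $\sup_{t\in[a,b]}d(f(t),g(t))\le c/2$. A step function is a function for which there is a finite partition $a=s_0<\dots<s_m=b$ such that it is constant on each open interval $(s_{i-1},s_i)$; piecewise linear means that there is such a partition with the function affine on each open interval $(s_{i-1},s_i)$ (jumps at the partition points are allowed a priori). *)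

(* Defs.v *)
From HB Require Import structures.
From mathcomp Require Import all_boot all_order all_algebra.
From mathcomp Require Import all_classical all_reals.
From mathcomp Require Import ereal topology normedtype numfun.

Set Implicit Arguments.
Unset Strict Implicit.
Unset Printing Implicit Defensive.

Import Order.TTheory GRing.Theory Num.Theory.
Import numFieldNormedType.Exports.

Local Open Scope classical_set_scope.
Local Open Scope ring_scope.

(** MathComp-Analysis.  A function [a,b] -> E is a total function f : R -> E
    of which only the values on [a,b] matter: every definition below is
    insensitive to the values of its function arguments outside [a,b]. *)

Section metric.
Context {R : realType} {E : metricType R}.
Implicit Types (a b delta : R) (f g : R -> E).

Definition regulated a b f : Prop :=
  (forall t, a <= t < b -> exists l : E, f x @[x --> t^'+] --> l) /\
  (forall t, a < t <= b -> exists l : E, f x @[x --> t^'-] --> l).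

Definition truncated_variation delta a b g : \bar R :=
  ereal_sup [set v | exists (n : nat) (t : nat -> R),
    [/\ a <= t 0%N,
        forall i, (i < n)%N -> t i < t i.+1,
        t n <= b &
        v = (\sum_(1 <= i < n.+1)
               Num.max (mdist (g (t i)) (g (t i.-1)) - delta) 0)%:E]].

Definition total_variation a b g : \bar R := truncated_variation 0 a b g.

Definition sup_dist a b f g : \bar R :=
  ereal_sup [set (mdist (f t) (g t))%:E | t in `[a, b]].

(** The set B(f, r). *)
Definition sup_ball a b f (r : R) : set (R -> E) :=
  [set g | (sup_dist a b f g <= r%:E)%E].

(** The partition points are a :: s, the last one being b. *)
Definition step_function a b g : Prop :=
  exists2 s : seq R, itv_partition a b s &
    forall i, (i < size s)%N ->
      exists x : E, forall t, nth b (a :: s) i < t < nth b s i -> g t = x.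

(** For a regulated f this says that f(t+) <> f(t) or f(t-) <> f(t), where
    only the one-sided limits taken inside [a,b] are considered. *)
Definition jump a b f (t : R) : Prop :=
  (a <= t < b /\ ~ (f x @[x --> t^'+] --> f t)) \/
  (a < t <= b /\ ~ (f x @[x --> t^'-] --> f t)).

End metric.

Definition piecewise_linear {R : realType} {V : lmodType R} (a b : R)
    (g : R -> V) : Prop :=
  exists2 s : seq R, itv_partition a b s &
    forall i, (i < size s)%N ->
      exists u v : V, forall t, nth b (a :: s) i < t < nth b s i ->
        g t = u + t *: v.

(* Main.v *)
(* Starting at [a], follow [f] until it first leaves the closed ball of radius
   [c / 2] around its value at the start, and restart there, either at the
   point reached or at its right germ; regulatedness bounds the number of
   restarts. The step function keeps the starting value on each piece. Its
   jumps join limits of [f] at increasing germs and are at least [c / 2], hence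
   [d <= lambda * (d - (lambda - 1) * c / (2 * lambda))] for each jump [d],
   which gives the upper bound. When [f] does not jump at a restart, the
   consecutive values are within [c / 2] of each other, and interpolating
   affinely between them over the preceding piece removes the jump without
   changing the total variation. *)
Require Import Defs.
From HB Require Import structures.
From mathcomp Require Import all_boot all_order all_algebra.
From mathcomp Require Import all_classical all_reals.
From mathcomp Require Import ereal topology normedtype numfun.
From mathcomp Require Import ring lra.

Set Implicit Arguments.
Unset Strict Implicit.
Unset Printing Implicit Defensive.

Import Order.TTheory GRing.Theory Num.Theory.
Import numFieldNormedType.Exports.

Local Open Scope classical_set_scope.
Local Open Scope ring_scope.

(** * One-sided limits in epsilon form *)

Section one_sided_limits.
Context {R : realType} {E : metricType R}.
Implicit Types (f : R -> E) (t : R) (l : E).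

Lemma cvg_at_right_mdistP f t l :
  f x @[x --> t^'+] --> l <->
  forall e, 0 < e ->
    exists2 w, t < w & forall x, t < x -> x < w -> mdist l (f x) < e.
Proof.
split=> [/metricType_numDomainType.cvgrPdist_lt fl e e0|fl].
  have [/= h h0 H] := fl e e0.
  exists (t + h); first by rewrite ltrDl.
  by move=> x tx xh; apply: H => //=; rewrite ltr0_norm ?subr_lt0//; lra.
apply/metricType_numDomainType.cvgrPdist_lt => e /fl[w tw H].
near=> x; apply: H; first by near: x; exact: nbhs_right_gt.
by near: x; exact: nbhs_right_lt.
Unshelve. all: by end_near. Qed.

Lemma cvg_at_left_mdistP f t l :
  f x @[x --> t^'-] --> l <->
  forall e, 0 < e ->
    exists2 w, w < t & forall x, w < x -> x < t -> mdist l (f x) < e.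
Proof.
split=> [/metricType_numDomainType.cvgrPdist_lt fl e e0|fl].
  have [/= h h0 H] := fl e e0.
  exists (t - h); first by rewrite gtrBl.
  by move=> x tx xh; apply: H => //=; rewrite gtr0_norm ?subr_gt0//; lra.
apply/metricType_numDomainType.cvgrPdist_lt => e /fl[w tw H].
near=> x; apply: H; last by near: x; exact: nbhs_left_lt.
by near: x; exact: nbhs_left_gt.
Unshelve. all: by end_near. Qed.

End one_sided_limits.

(* The germ (t, false) is the point t, and (t, true) its right germ t+; germs
   are ordered lexicographically. *)
Definition germ (R : realType) := (R * bool)%type.

Definition germ_lt {R : realType} (s s' : germ R) : Prop :=
  s.1 < s'.1 \/ [/\ s.1 = s'.1, ~~ s.2 & s'.2].

Definition germ_le_pt {R : realType} (s : germ R) (t : R) : bool :=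
  if s.2 then s.1 < t else s.1 <= t.

Definition germ_in {R : realType} (a b : R) (s : germ R) : bool :=
  (a <= s.1 <= b) && (s.2 ==> (s.1 < b)).

Definition germ_lim {R : realType} {E : metricType R} (g : R -> E)
    (s : germ R) (x : E) : Prop :=
  if s.2 then g y @[y --> s.1^'+] --> x else g s.1 = x.

(** * Order and limits at germs *)

Section germs.
Context {R : realType} {E : metricType R}.
Implicit Types (s : germ R) (t : R).

Lemma germ_lt_fst s s' : germ_lt s s' -> s.1 <= s'.1.
Proof. by case=> [/ltW//|[-> _ _]]. Qed.

(** Only two germs share a base point, so two strict increases must move it. *)
Lemma germ_lt_lt_fst s s' s'' : germ_lt s s' -> germ_lt s' s'' -> s.1 < s''.1.
Proof.
by case=> [?|[-> _ i]] [?|[<- n _]] //; [lra | move: n; rewrite i].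
Qed.

Lemma germ_lt_le_pt s s' t : germ_lt s s' -> germ_le_pt s' t -> germ_le_pt s t.
Proof.
case: s s' => [u i] [v j]; rewrite /germ_lt /germ_le_pt /=.
case=> [uv|[-> /negbTE ->]]; case: i; case: j => //; lra.
Qed.

Lemma germ_le_pt_mono s t t' : t <= t' -> germ_le_pt s t -> germ_le_pt s t'.
Proof. by case: s => u []; rewrite /germ_le_pt/= => ? ?; lra. Qed.

(** The bound [w] serves to keep the approximating point before the next germ of a chain. *)
Lemma germ_lim_mdist (g : R -> E) s x w e : germ_lim g s x -> 0 < e ->
  s.1 < w -> exists2 u, (if s.2 then s.1 < u < w else u == s.1) &
                        mdist x (g u) < e.
Proof.
rewrite /germ_lim; case: s.2.
  move=> /cvg_at_right_mdistP gx /gx[w' sw' H] sw.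
  have sm : s.1 < Num.min w w' by rewrite lt_min sw sw'.
  exists ((s.1 + Num.min w w') / 2).
    by rewrite !midf_lt //= (lt_le_trans (midf_lt sm).2)// ge_min lexx.
  by apply: H; rewrite ?midf_lt// (lt_le_trans (midf_lt sm).2)// ge_min lexx orbT.
by move=> <- e0 _; exists s.1; rewrite ?mdistxx.
Qed.

End germs.

(** * Bounding the variation from below along germs and from above by a length *)

Section variation_bounds.
Context {R : realType} {E : metricType R}.
Implicit Types (a b delta : R) (g : R -> E).

Lemma points_in_itv a b (n : nat) (t : nat -> R) :
  a <= t 0%N -> (forall i, (i < n)%N -> t i < t i.+1) -> t n <= b ->
  forall i, (i <= n)%N -> a <= t i <= b.
Proof.
move=> at0 tlt tnb i ilen; apply/andP; split.
  elim: i ilen => // i IH ilen.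
  by rewrite (le_trans (IH (ltnW ilen)))// ltW// tlt.
rewrite -(subKn ilen); elim: (n - i)%N => [|k IH]; first by rewrite subn0.
apply: le_trans IH; rewrite subnS.
case: (posnP (n - k)%N) => [->//|nk]; apply/ltW.
by rewrite -{2}(prednK nk); apply: tlt; rewrite prednK// leq_subr.
Qed.

(** Right germs are replaced by nearby points to their right, chosen so close that the order is kept
    and the sum drops by at most an arbitrary [e]. *)
Lemma truncated_variation_ge_germs delta a b g (s : nat -> germ R)
    (x : nat -> E) (m : nat) :
  (forall j, (j <= m)%N -> germ_in a b (s j)) ->
  (forall j, (j < m)%N -> germ_lt (s j) (s j.+1)) ->
  (forall j, (j <= m)%N -> germ_lim g (s j) (x j)) ->
  ((\sum_(1 <= i < m.+1) Num.max (mdist (x i) (x i.-1) - delta) 0)%:E <=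
   truncated_variation delta a b g)%E.
Proof.
move=> sin slt slim; apply/lee_addgt0Pr => e e0.
(* Moving both ends of an increment by [d] costs at most [2 * d]; [m.+1] such costs add up to [e],
   which covers the [m] increments. *)
pose d := e / (2 * m.+1%:R); have d0 : 0 < d by rewrite divr_gt0// mulr_gt0.
(* For a right germ the point must stay left of the next base point; [b] is the bound for the last
   germ and the default when the two base points coincide. *)
have /choice[u uP] : forall j, exists v : R, (j <= m)%N ->
    (if (s j).2 then (s j).1 < v < (if j == m then b else
       if (s j.+1).1 == (s j).1 then b else (s j.+1).1)
     else v == (s j).1) /\ mdist (x j) (g v) < d.
  move=> j; have [jm|jm] := boolP (j <= m)%N; last by exists 0.
  case sj2: (s j).2; last first.
    exists (s j).1; split => //; have := slim j jm.
    by rewrite /germ_lim sj2 => ->; rewrite mdistxx.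
  set w := (if _ then _ else _).
  have sw : (s j).1 < w.
    have := sin j jm; rewrite /germ_in sj2 /= => /andP[_ sb]; rewrite /w.
    case: eqVneq => // jnm; case: eqVneq => // ne.
    have jltm : (j < m)%N by rewrite ltn_neqAle jnm.
    by rewrite lt_neqAle eq_sym ne (germ_lt_fst (slt j jltm)).
  have [v] := germ_lim_mdist (slim j jm) d0 sw.
  by rewrite sj2 => ? ?; exists v.
have ulow j : (j <= m)%N -> (s j).1 <= u j.
  move=> jm; have [+ _] := uP j jm.
  by case: (s j).2 => [/andP[/ltW]//|/eqP ->].
have ult j : (j < m)%N -> u j < u j.+1.
  move=> jm; have sub := ulow j.+1 jm.
  have [+ _] := uP j (ltnW jm); rewrite (ltn_eqF jm).
  case: (slt j jm) => [sj|[e1 n1 n2]].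
    rewrite (gt_eqF sj); case: (s j).2 => [/andP[_ h]|/eqP ->].
      exact: lt_le_trans sub.
    exact: lt_le_trans sub.
  rewrite (negbTE n1) => /eqP ->.
  by have [+ _] := uP j.+1 jm; rewrite n2 e1 => /andP[].
have ua : a <= u 0%N.
  by apply: le_trans (ulow 0%N _) => //; have /andP[/andP[]] := sin 0%N isT.
have ub : u m <= b.
  have [+ _] := uP m (leqnn m); rewrite eqxx.
  case: (s m).2 => [/andP[_ /ltW]//|/eqP ->].
  by have /andP[/andP[]] := sin m (leqnn m).
apply: (@le_trans _ _ ((\sum_(1 <= i < m.+1)
    Num.max (mdist (g (u i)) (g (u i.-1)) - delta) 0)%:E + e%:E)%E); last first.
  by rewrite leeD2r//; apply: ereal_sup_ubound; exists m, u; split.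
rewrite -EFinD lee_fin.
have -> : e = \sum_(0 <= i < m.+1) (2 * d).
  rewrite sumr_const_nat subn0 -mulr_natr /d.
  by rewrite mulrA -mulrA mulrC; field; rewrite ?pnatr_eq0.
rewrite [leRHS]addrC.
have : \sum_(1 <= i < m.+1) (2 * d) <= \sum_(0 <= i < m.+1) (2 * d).
  by rewrite [leRHS]big_nat_recl// big_add1 lerDr mulr_ge0// ltW.
move=> h; apply: le_trans (lerD h (lexx _)); rewrite -big_split/=.
rewrite big_nat [leRHS]big_nat; apply: ler_sum => i /andP[i0 im].
rewrite ge_max; apply/andP; split; last first.
  by apply: addr_ge0; [rewrite mulr_ge0 ?(ltW d0)|rewrite le_max lexx orbT].
have [_ h1] := uP i im; have im' : (i.-1 <= m)%N by rewrite (leq_trans (leq_pred _)).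
have [_ h2] := uP i.-1 im'.
have t1 := metric_triangle (x i) (g (u i)) (x i.-1).
have t2 := metric_triangle (g (u i)) (g (u i.-1)) (x i.-1).
rewrite (metric_sym (g (u i.-1))) in t2.
have : mdist (g (u i)) (g (u i.-1)) - delta <=
  Num.max (mdist (g (u i)) (g (u i.-1)) - delta) 0 by rewrite le_max lexx.
lra.
Qed.

(** The increments of [l] telescope over the points. The hypothesis also makes [l] nondecreasing on
    [a, b], so passing from the extreme points to [a] and [b] only enlarges the bound. *)
Lemma total_variation_le_length a b g (l : R -> R) :
  (forall r t, a <= r -> r <= t -> t <= b -> mdist (g t) (g r) <= l t - l r) ->
  (total_variation a b g <= (l b - l a)%:E)%E.
Proof.
move=> gl; apply: ge_ereal_sup => _ [n [t [at0 tlt tnb ->]]].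
have tin := points_in_itv at0 tlt tnb.
rewrite lee_fin; apply: (@le_trans _ _ (l (t n) - l (t 0%N))).
  rewrite -(telescope_sumr (fun i => l (t i)))// big_add1 /=.
  rewrite big_nat [leRHS]big_nat; apply: ler_sum => i im.
  have /andP[ai _] := tin i (ltnW im); have /andP[_ ib] := tin i.+1 im.
  have := gl (t i) (t i.+1) ai (ltW (tlt i im)) ib.
  by rewrite subr0 ge_max => h; rewrite h (le_trans _ h)// mdist_ge0.
have /andP[a0 _] := tin 0%N isT; have /andP[an _] := tin n (leqnn n).
have /andP[_ b0] := tin 0%N isT.
have h1 := gl a (t 0%N) (lexx a) a0 b0.
have h2 := gl (t n) b an tnb (lexx b).
have := mdist_ge0 (g (t 0%N)) (g a); have := mdist_ge0 (g b) (g (t n)); lra.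
Qed.

End variation_bounds.

(** * Greedy choice of the restart germs *)

Section greedy.
Context {R : realType} {E : metricType R} (a b c : R) (f r : R -> E).

(** [r] stands for the right limits of [f], as [hr] requires. *)
Definition germ_val (s : germ R) : E := if s.2 then r s.1 else f s.1.

Definition greedy_end (s : germ R) : Prop :=
  forall t, t <= b -> germ_le_pt s t -> mdist (germ_val s) (f t) <= c / 2.

(* The germ [s'] is the first one after [s] at which [f] is no longer within
   [c / 2] of its value at [s]. *)
Definition greedy_next (s s' : germ R) : Prop :=
  [/\ germ_lt s s', germ_in a b s',
      c / 2 <= mdist (germ_val s) (germ_val s'),
      forall t, germ_le_pt s t -> ~~ germ_le_pt s' t ->
        mdist (germ_val s) (f t) <= c / 2 &
      ~ jump a b f s'.1 ->
        [/\ s.1 < s'.1, s'.2 & mdist (germ_val s) (germ_val s') <= c / 2]].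

Hypothesis hc : 0 < c.
Hypothesis hr : forall t, a <= t < b -> f x @[x --> t^'+] --> r t.

Lemma germ_val_lim s : germ_in a b s -> germ_lim f s (germ_val s).
Proof.
case: s => t []; rewrite /germ_lim /germ_in/= => /andP[/andP[ta _] tb]//.
by apply: hr; rewrite ta.
Qed.

Lemma mdist_right_lim_ge t (x : E) : a <= t < b ->
  (forall w, t < w -> exists2 u, t < u < w & c / 2 < mdist x (f u)) ->
  c / 2 <= mdist x (r t).
Proof.
move=> /hr/cvg_at_right_mdistP ft xu; apply/ler_addgt0Pr => e e0.
have [w tw fw] := ft e e0.
have [u /andP[tu uw] hu] := xu w tw.
have := metric_triangle x (r t) (f u); have := fw u tu uw; lra.
Qed.

Lemma mdist_left_lim_le t w (x : E) : f y @[y --> t^'-] --> f t -> w < t ->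
  (forall u, w < u -> u < t -> mdist x (f u) <= c / 2) ->
  mdist x (f t) <= c / 2.
Proof.
move=> /cvg_at_left_mdistP ft wt xu; apply/ler_addgt0Pr => e e0.
have [w' w't fw] := ft e e0.
have mt : Num.max w w' < t by rewrite gt_max wt.
pose u := (Num.max w w' + t) / 2.
have [mu ut] : Num.max w w' < u /\ u < t by rewrite /u !midf_lt.
move: mu; rewrite gt_max => /andP[wu w'u].
have := metric_triangle x (f u) (f t); rewrite (metric_sym (f u)).
have := fw u w'u ut; have := xu u wu ut; lra.
Qed.

(** Let [v] be the infimum of the exit points [A]. If [v] is an exit point, the next germ is [v]
    itself; otherwise exit points accumulate at [v] from the right and the next germ is the right
    germ of [v]. *)
Lemma greedy_step s : germ_in a b s -> ~ greedy_end s ->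
  exists s', greedy_next s s'.
Proof.
move=> sin; have /andP[/andP[as1 sb] s2b] := sin.
pose A := [set t | [/\ t <= b, germ_le_pt s t & c / 2 < mdist (germ_val s) (f t)]].
move=> nend; have A0 : A !=set0.
  apply: contra_notP nend => nA t tb st; rewrite leNgt; apply/negP => h.
  by apply: nA; exists t.
have s_le t : germ_le_pt s t -> s.1 <= t.
  by rewrite /germ_le_pt; case: s.2 => // /ltW.
have lbA : lbound A s.1 by move=> t [_ /s_le].
have hinf : has_inf A by split=> //; exists s.1.
have hlb : has_lbound A by exists s.1.
pose v := inf A.
have sv : s.1 <= v by apply: lb_le_inf.
have vA t : A t -> v <= t by move=> At; apply: ge_inf.
have vb : v <= b by have [t At] := A0; apply: le_trans (vA _ At) _; case: At.
have before t : germ_le_pt s t -> t < v -> mdist (germ_val s) (f t) <= c / 2.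
  move=> st tv; rewrite leNgt; apply/negP => h.
  by have := vA t (And3 (le_trans (ltW tv) vb) st h); rewrite leNgt tv.
have near_v w : v < w -> exists2 t, A t & t < w.
  move=> vw; have w0 : 0 < w - v by rewrite subr_gt0.
  have [t At tw] := inf_adherent w0 hinf; exists t => //.
  by move: tw; rewrite -/v addrC subrK.
have [Av|nAv] := pselect (A v).
  have [_ lev dv] := Av; exists (v, false).
  have sltv : s.1 < v.
    move: lev dv; rewrite /germ_le_pt /germ_val; case: s.2 => // _.
    rewrite [s.1 < v]lt_neqAle sv andbT; case: eqVneq => //= ->.
    by rewrite mdistxx => h; have : c < 0 by [lra]; rewrite ltNge ltW.
  split.
  - by left.
  - by rewrite /germ_in/= vb (le_trans as1 sv).
  - exact: ltW.
  - by move=> t st; rewrite /germ_le_pt/= -ltNge; exact: before.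
  (* Left continuity at [v] would carry the bound [c / 2] over from the points before [v], so [f]
     must jump there. *)
  - rewrite /= => njump; exfalso.
    have : mdist (germ_val s) (f v) <= c / 2; last by rewrite leNgt dv.
    apply: (@mdist_left_lim_le v s.1) => //.
      apply: contra_notP njump => nc; right; split=> //.
      by rewrite vb (le_lt_trans as1 sltv).
    move=> u su uv; apply: before => //.
    by rewrite /germ_le_pt; case: s.2 => //; exact: ltW.
have Av_gt w : v < w -> exists2 u, v < u < w & c / 2 < mdist (germ_val s) (f u).
  move=> /near_v[u Au uw]; exists u; last by case: Au.
  rewrite uw andbT lt_neqAle (vA _ Au) andbT; apply: contra_notN nAv => /eqP ->.
  by [].
have vltb : v < b.
  have [u Au] := A0; have [ub _ _] := Au; apply: lt_le_trans ub.
  rewrite lt_neqAle (vA _ Au) andbT; apply: contra_notN nAv => /eqP ->.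
  by [].
have rv : c / 2 <= mdist (germ_val s) (r v).
  by apply: mdist_right_lim_ge => //; rewrite vltb (le_trans as1 sv).
(* Restarting at the same right germ would make the distance in [rv] zero, while [c] is positive. *)
have s2v : s.2 -> s.1 < v.
  move=> s2; rewrite lt_neqAle sv andbT; apply/eqP => e.
  by move: rv; rewrite /germ_val s2 e mdistxx leNgt divr_gt0.
have upto t : germ_le_pt s t -> t <= v -> mdist (germ_val s) (f t) <= c / 2.
  move=> st; rewrite le_eqVlt => /orP[/eqP tv|]; last exact: before.
  rewrite leNgt; apply/negP => h; apply: nAv; rewrite -tv.
  by split=> //; rewrite tv.
have levs : germ_le_pt s v.
  by rewrite /germ_le_pt; case s2: s.2; [exact: s2v|].
exists (v, true); split.
- rewrite /germ_lt /=; case s2: s.2; first by left; exact: s2v.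
  by have [<-|ne] := eqVneq s.1 v; [right|left; rewrite lt_neqAle ne].
- by rewrite /germ_in/= vb vltb (le_trans as1 sv).
- exact: rv.
- by move=> t st; rewrite /germ_le_pt/= -leNgt; exact: upto.
- rewrite /germ_val/= -/(germ_val s) => njump.
  (* Without a jump the right limit is [f v], and [v] is not an exit point; hence the distance to
     [r v] is also at most [c / 2]. *)
  have rf : r v = f v.
    have avb : a <= v < b by rewrite vltb (le_trans as1 sv).
    apply: contra_notP njump => nrf; left; split=> // fv; apply: nrf.
    exact: (cvg_unique (@metric_hausdorff _ E) (hr avb) fv).
  have lerv : mdist (germ_val s) (r v) <= c / 2 by rewrite rf; exact: upto.
  split=> //; case s2: s.2; first exact: s2v.
  rewrite lt_neqAle sv andbT; apply/eqP => e.
  by move: rv; rewrite /germ_val s2 rf e mdistxx leNgt divr_gt0.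
Qed.

Hypothesis hl : forall t, a < t <= b -> exists l : E, f x @[x --> t^'-] --> l.

(** The base points would increase to some [t], and the values at the germs would approach the left
    limit of [f] at [t], although consecutive values stay at least [c / 2] apart. *)
Lemma no_infinite_greedy (s : nat -> germ R) : germ_in a b (s 0%N) ->
  ~ (forall n, greedy_next (s n) (s n.+1)).
Proof.
move=> s0 snext.
have sin n : germ_in a b (s n) by case: n => // n; have [] := snext n.
have slt n : germ_lt (s n) (s n.+1) by have [] := snext n.
pose A := range (fun n => (s n).1).
have hub : has_ubound A.
  by exists b => _ [n _ <-]; have /andP[/andP[]] := sin n.
have hsup : has_sup A by split=> //; exists (s 0%N).1, 0%N.
pose t := sup A.
(* Two steps ahead the base point has strictly increased, so the supremum is never attained. *)
have st n : (s n).1 < t.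
  apply: (lt_le_trans (germ_lt_lt_fst (slt n) (slt n.+1))).
  by apply: ub_le_sup => //; exists n.+2.
have tb : t <= b.
  by apply: ge_sup; [case: hsup|move=> _ [n _ <-]; have /andP[/andP[]] := sin n].
have at_ : a < t by apply: le_lt_trans (st 0%N); have /andP[/andP[]] := s0.
have [|l /cvg_at_left_mdistP fl] := hl (t := t); first by rewrite at_.
(* An error [c / 8] for the left limit and another for approximating the germ value put each value
   within [c / 4] of [l], hence two values less than [c / 2] apart. *)
have c8 : 0 < c / 8 by rewrite divr_gt0.
have [w wt fw] := fl _ c8.
have [_ [n _ <-]] : exists2 x, A x & w < x.
  have tw : 0 < t - w by rewrite subr_gt0.
  have [x Ax] := sup_adherent tw hsup; rewrite -/t opprB addrC subrK.
  by exists x.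
move=> wsn.
have close k : (n <= k)%N -> mdist l (germ_val (s k)) < c / 4.
  move=> nk; have wsk : w < (s k).1.
    apply: (lt_le_trans wsn); elim: k nk => [|k IH].
      by rewrite leqn0 => /eqP ->.
    rewrite leq_eqVlt => /orP[/eqP ->//|/IH]; rewrite /=.
    by move=> h; exact: le_trans (germ_lt_fst (slt k)).
  have [u uP du] := germ_lim_mdist (germ_val_lim (sin k)) c8 (st k).
  have : mdist l (f u) < c / 8.
    by move: uP; case: (s k).2 => [/andP[? ?]|/eqP ->]; apply: fw => //; lra.
  have := metric_triangle l (f u) (germ_val (s k)).
  rewrite (metric_sym (f u)); lra.
have := close n (leqnn n); have := close n.+1 (leqnSn n).
have := metric_triangle (germ_val (s n)) l (germ_val (s n.+1)).
rewrite (metric_sym _ l); have [_ _ + _ _] := snext n.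
move=> h1 h2 h3 h4; have : c < c by [lra]; by rewrite ltxx.
Qed.

(** The chosen successor is iterated from the point [a], and the chain is cut at the first index
    satisfying [greedy_end]. *)
Lemma greedy_chain : a < b -> exists (s : nat -> germ R) (m : nat),
  [/\ s 0%N = (a, false), forall j, (j <= m)%N -> germ_in a b (s j),
      forall j, (j < m)%N -> greedy_next (s j) (s j.+1) & greedy_end (s m)].
Proof.
move=> hab.
have /choice[nx nxP] : forall s, exists s', germ_in a b s -> ~ greedy_end s ->
    greedy_next s s'.
  move=> s; have [sin|] := boolP (germ_in a b s); last by exists s.
  have [|ns] := pselect (greedy_end s); first by exists s.
  by have [s' ?] := greedy_step sin ns; exists s'.
pose s n := iter n nx (a, false).
have s0 : germ_in a b (s 0%N) by rewrite /germ_in/= lexx ltW.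
have sP n : (forall j, (j < n)%N -> ~ greedy_end (s j)) ->
    germ_in a b (s n) /\ forall j, (j < n)%N -> greedy_next (s j) (s j.+1).
  elim: n => [//|n IH] nend.
  have [sn sn'] := IH (fun j jn => nend j (ltnW jn)).
  have nxn : greedy_next (s n) (s n.+1) by apply: nxP => //; exact: nend.
  split=> [|j]; first by have [] := nxn.
  by rewrite ltnS leq_eqVlt => /orP[/eqP ->//|]; exact: sn'.
have [exE|nE] := pselect (exists n, `[< greedy_end (s n) >]).
  case: (ex_minnP exE) => m /asboolP mend mmin; exists s, m.
  have nend j : (j < m)%N -> ~ greedy_end (s j).
    by move=> jm /asboolP /mmin; rewrite leqNgt jm.
  split=> //; last by have [] := sP m nend.
  move=> j jm; have [] // := sP j (fun i ij => nend i (leq_trans ij jm)).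
exfalso; apply: (no_infinite_greedy s0) => n.
have [|_] := sP n.+1; last exact.
by move=> j _ h; apply: nE; exists j; apply/asboolP.
Qed.

End greedy.

(** * Partitions adapted to a finite set *)

Section partition.
Context {R : realType}.

(** The nodes are the entries of [q] in (a, b), sorted, followed by [b]. An entry strictly between
    consecutive nodes would itself be a node, with an index strictly between two consecutive
    integers. *)
Lemma itv_partition_avoiding (a b : R) (q : seq R) : a < b ->
  exists2 p : seq R, itv_partition a b p &
    forall i x, (i < size p)%N -> x \in q ->
      ~~ (nth b (a :: p) i < x < nth b p i).
Proof.
move=> ab; pose p' := sort <=%O (undup [seq x <- q | a < x < b]).
have p'P x : (x \in p') = (a < x < b) && (x \in q).
  by rewrite mem_sort mem_undup mem_filter.
have part : itv_partition a b (rcons p' b).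
  split; last by rewrite last_rcons.
  rewrite rcons_path path_min_sorted; last first.
    by apply/allP => x; rewrite p'P => /andP[/andP[]].
  rewrite sort_lt_sorted undup_uniq/=.
  have := mem_last a p'; rewrite inE => /predU1P[->//|].
  by rewrite p'P => /andP[/andP[]].
exists (rcons p' b) => // i x ip xq; apply/negP => /andP[ix xi].
have ax : a < x.
  apply: le_lt_trans ix; apply: itv_partition_nth_ge part.
  exact: leq_trans ip (leqnSn _).
have xb : x < b.
  by apply: lt_le_trans xi (@itv_partition_nth_le _ _ a b _ i.+1 ip part).
have xp : x \in a :: rcons p' b.
  by rewrite inE mem_rcons inE p'P ax xb xq !orbT.
have [srt _] := part.
have mono := @lt_sorted_ltn_nth _ _ b (a :: rcons p' b) srt.
move: ix xi; rewrite -(nth_index b xp) -[nth b (rcons p' b) i]/(nth b (a :: _) i.+1).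
rewrite !mono ?[_ \in _]index_mem//; last by rewrite inE/= ltnS ltnW.
by move=> h1 h2; move: (leq_trans h1 h2); rewrite ltnn.
Qed.

End partition.

(** * The pieces between consecutive germs *)

Section pieces.
Context {R : realType} (a : R) (s : nat -> germ R) (m : nat).

(* The germs [s 0 < ... < s m] cut the line into consecutive pieces; this is
   the index of the piece containing [t]. *)
Definition piece (t : R) : nat := \max_(j < m.+1 | germ_le_pt (s j) t) j.

Hypothesis s0 : s 0%N = (a, false).
Hypothesis slt : forall j, (j < m)%N -> germ_lt (s j) (s j.+1).

Lemma piece_le t : (piece t <= m)%N.
Proof. by apply/bigmax_leqP => j _; rewrite -ltnS. Qed.

Lemma le_piece j t : (j <= m)%N -> germ_le_pt (s j) t -> (j <= piece t)%N.
Proof.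
rewrite -ltnS => jm st.
exact: (@leq_bigmax_cond _ (fun i : 'I_m.+1 => germ_le_pt (s i) t)
  (@nat_of_ord _) (Ordinal jm)).
Qed.

Lemma piece_germ_le t : a <= t -> germ_le_pt (s (piece t)) t.
Proof.
move=> ta.
have card0 : (0 < #|[pred j : 'I_m.+1 | germ_le_pt (s j) t]|)%N.
  by apply/card_gt0P; exists ord0; rewrite inE/= s0.
by have [j jP e] := eq_bigmax_cond (@nat_of_ord _) card0; rewrite /piece e.
Qed.

Lemma piece_mono t t' : t <= t' -> (piece t <= piece t')%N.
Proof.
move=> tt'; apply/bigmax_leqP => j jP; apply: le_piece; first by rewrite -ltnS.
exact: germ_le_pt_mono jP.
Qed.

Lemma piece_const u v t t' :
  (forall j, (j <= m)%N -> ~~ (u < (s j).1 < v)) ->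
  u < t < v -> u < t' < v -> piece t = piece t'.
Proof.
move=> sout tuv t'uv; apply: eq_bigl => j.
have /sout : (j <= m)%N by rewrite -ltnS.
move: tuv t'uv; rewrite /germ_le_pt; case: (s j).2; lra.
Qed.

Lemma germ_le_pt_anti i j t : (i <= j <= m)%N ->
  germ_le_pt (s j) t -> germ_le_pt (s i) t.
Proof.
move=> /andP[ij]; move: ij; elim: j => [|j IH].
  by rewrite leqn0 => /eqP ->.
rewrite leq_eqVlt => /predU1P[->//|ij jm sj].
by apply: IH => //; [exact: ltnW|exact: germ_lt_le_pt (slt jm) sj].
Qed.

Lemma piece_ltN t : (piece t < m)%N -> ~~ germ_le_pt (s (piece t).+1) t.
Proof.
by move=> km; apply/negP => /(le_piece km); rewrite ltnn.
Qed.

Lemma piece_eq j t : (j <= m)%N -> germ_le_pt (s j) t ->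
  ((j < m)%N -> ~~ germ_le_pt (s j.+1) t) -> piece t = j.
Proof.
move=> jm sj sj1; apply/eqP; rewrite eqn_leq le_piece// andbT.
apply/bigmax_leqP => i si; rewrite leqNgt; apply/negP => ji.
have im : (i <= m)%N by rewrite -ltnS.
have /negP[] := sj1 (leq_trans ji im).
by apply: germ_le_pt_anti si; rewrite ji.
Qed.

Lemma piece_germ j : (j <= m)%N -> ~~ (s j).2 -> piece (s j).1 = j.
Proof.
move=> jm /negbTE s2; apply: piece_eq => // [|jltm].
  by rewrite /germ_le_pt s2.
by rewrite /germ_le_pt; case: (slt jltm) => [|[-> _ ->]]; [case: ifP; lra|lra].
Qed.

Lemma piece_germ_right j : (j <= m)%N -> (s j).2 ->
  exists2 w, (s j).1 < w &
    forall t, (s j).1 < t -> t < w -> piece t = j.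
Proof.
move=> jm s2; have [->|jnm] := eqVneq j m.
  exists ((s m).1 + 1) => [|t st _]; first by lra.
  apply: piece_eq => //; last by rewrite ltnn.
  by rewrite /germ_le_pt; case: (s m).2 => //; exact: ltW.
have jltm : (j < m)%N by rewrite ltn_neqAle jnm.
exists (s j.+1).1 => [|t st ts].
  by case: (slt jltm) => // -[_]; rewrite s2.
apply: piece_eq => // [|_]; rewrite /germ_le_pt ?s2//.
by case: (s j.+1).2; lra.
Qed.

(** The next germ is not at or before the point [t]: its base point is either beyond [t], or it is
    the right germ of [t]. *)
Lemma piece_right t : a <= t ->
  (exists2 w, t < w & forall y, t < y -> y < w -> piece y = piece t) \/
  ((piece t < m)%N /\ s (piece t).+1 = (t, true)).
Proof.
move=> ta; have st := piece_germ_le ta.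
have [km|km] := eqVneq (piece t) m.
  left; exists (t + 1) => [|y ty _]; first by lra.
  by apply/eqP; rewrite eqn_leq (piece_mono (ltW ty)) andbT km piece_le.
have kltm : (piece t < m)%N by rewrite ltn_neqAle km piece_le.
have := piece_ltN kltm; case e : (s _) => [v i]; rewrite /germ_le_pt/= => nsv.
have [tv|vt] := ltP t v.
  left; exists v => // y ty yv; apply: piece_eq => //; first exact: piece_le.
    exact: germ_le_pt_mono (ltW ty) st.
  by rewrite e /germ_le_pt/=; case: (i); lra.
right; split=> //; move: nsv; case: (i) => //=; last by rewrite vt.
by rewrite -leNgt => tv; rewrite (@le_anti _ _ v t) ?vt.
Qed.

(** The germ opening the piece of [t] is based either before [t] or at [t]; a right germ at [t]
    would exclude [t], and index 0 is excluded by [a < t]. *)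
Lemma piece_left t : a < t ->
  (exists2 w, w < t & forall y, w < y -> y < t -> piece y = piece t) \/
  ((0 < piece t)%N /\ s (piece t) = (t, false)).
Proof.
move=> ta; have := piece_germ_le (ltW ta).
case e : (s _) => [v i] st.
have [vt|tv] := ltP v t.
  left; exists v => // y vy yt; apply: piece_eq => //; first exact: piece_le.
    by rewrite e /germ_le_pt/=; case: (i) => //; exact: ltW.
  by move=> /piece_ltN; apply: contra; apply: germ_le_pt_mono; exact: ltW.
have ei : i = false.
  by move: st; rewrite /germ_le_pt/=; case: (i) => //; lra.
have ev : v = t.
  by apply/eqP; rewrite eq_le tv andbT; move: st; rewrite /germ_le_pt/= ei.
right; split; last by rewrite ei ev.
rewrite lt0n; apply/negP => /eqP k0; move: e; rewrite k0 s0 => -[av _].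
by move: ta; rewrite av ev ltxx.
Qed.

End pieces.

(** Here [g] travels along the chain [x 0], ..., [x m], and [p t] is the distance covered since
    [x (k t)]. The step function uses [p = 0], the piecewise linear one its offset along the current
    segment. *)
Lemma total_variation_le_path {R : realType} {E : metricType R} (a b : R)
    (g : R -> E) (x : nat -> E) (k : R -> nat) (p : R -> R) (m : nat) :
  a <= b ->
  (forall t, (k t <= m)%N) ->
  (forall t t', t <= t' -> (k t <= k t')%N) ->
  (forall t, a <= t <= b -> mdist (x (k t)) (g t) <= p t) ->
  (forall t, a <= t <= b -> (k t < m)%N ->
     mdist (g t) (x (k t).+1) <= mdist (x (k t).+1) (x (k t)) - p t) ->
  (forall t, a <= t <= b -> k t = m -> p t <= 0) ->
  (forall t t', a <= t -> t <= t' -> t' <= b -> k t = k t' ->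
     mdist (g t') (g t) <= p t' - p t) ->
  (total_variation a b g <= (\sum_(1 <= i < m.+1) mdist (x i) (x i.-1))%:E)%E.
Proof.
move=> ab km kmono H1 H2 H2m H3.
pose S n := \sum_(1 <= i < n.+1) mdist (x i) (x i.-1).
have SS n : S n.+1 = S n + mdist (x n.+1) (x n) by rewrite /S big_nat_recr.
have Sxx i j : (i <= j)%N -> mdist (x j) (x i) <= S j - S i.
  elim: j => [|j IH]; first by rewrite leqn0 => /eqP ->; rewrite mdistxx subrr.
  rewrite leq_eqVlt => /predU1P[->|/IH]; first by rewrite mdistxx subrr.
  have := metric_triangle (x j.+1) (x j) (x i); rewrite SS; lra.
have Smono i j : (i <= j)%N -> S i <= S j.
  by move=> /Sxx; have := mdist_ge0 (x j) (x i); lra.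
have p0 t : a <= t <= b -> 0 <= p t by move=> /H1; apply: le_trans; exact: mdist_ge0.
(* The length function is the distance travelled along the chain up to time [t]. *)
apply: le_trans (@total_variation_le_length _ _ a b g (fun t => S (k t) + p t) _) _.
  move=> t t' at_ tt' t'b.
  have tin : a <= t <= b by rewrite at_ (le_trans tt').
  have t'in : a <= t' <= b by rewrite t'b (le_trans at_).
  have [e|ne] := eqVneq (k t) (k t').
    by rewrite e; have := H3 t t' at_ tt' t'b e; lra.
  have kk : (k t < k t')%N by rewrite ltn_neqAle ne kmono.
  (* The way from [g t] to [g t'] is split at [x (k t).+1] and [x (k t')]. *)
  have := H2 t tin (leq_trans kk (km t')); have := H1 t' t'in.
  have := Sxx _ _ kk; rewrite SS.
  have := metric_triangle (g t') (x (k t')) (g t); rewrite (metric_sym (g t') (x (k t'))).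
  have := metric_triangle (x (k t')) (x (k t).+1) (g t).
  rewrite (metric_sym (x (k t).+1) (g t)); lra.
rewrite lee_fin -/(S m).
have ain : a <= a <= b by rewrite lexx.
have bin : a <= b <= b by rewrite lexx andbT.
have := p0 a ain; have := Smono 0%N (k a) (leq0n _).
have : S 0%N = 0 by rewrite /S big_nil.
have [e|ne] := eqVneq (k b) m; first by rewrite e; have := H2m b bin e; lra.
have kb : (k b < m)%N by rewrite ltn_neqAle ne km.
have := H2 b bin kb; have := Smono _ _ kb; rewrite SS.
have := mdist_ge0 (g b) (x (k b).+1); lra.
Qed.

(** * The step function and its total variation *)

Section approximation.
Context {R : realType} {E : metricType R} (a b c : R) (f r : R -> E).
Context (s : nat -> germ R) (m : nat).
Hypothesis hab : a < b.
Hypothesis hc : 0 < c.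
Hypothesis hr : forall t, a <= t < b -> f x @[x --> t^'+] --> r t.
Hypothesis s0 : s 0%N = (a, false).
Hypothesis sin : forall j, (j <= m)%N -> germ_in a b (s j).
Hypothesis snext : forall j, (j < m)%N -> greedy_next a b c f r (s j) (s j.+1).
Hypothesis send : greedy_end b c f r (s m).

Let slt j : (j < m)%N -> germ_lt (s j) (s j.+1).
Proof. by move=> /snext[]. Qed.

Local Notation x j := (germ_val f r (s j)).
Local Notation piece := (piece s m).
Local Notation length := (\sum_(1 <= i < m.+1) mdist (x i) (x i.-1)).

Definition greedy_step_fun (t : R) : E := x (piece t).

Lemma mdist_piece_le t : a <= t <= b -> mdist (x (piece t)) (f t) <= c / 2.
Proof.
move=> /andP[at_ tb]; have st := piece_germ_le m s0 at_.
have := piece_le s m t; rewrite leq_eqVlt => /predU1P[e|km].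
  by rewrite e in st *; exact: send.
by have [_ _ _ + _] := snext km; apply => //; exact: piece_ltN.
Qed.

Lemma greedy_step_fun_step : step_function a b greedy_step_fun.
Proof.
have [p part pout] := itv_partition_avoiding [seq (s j).1 | j <- iota 0 m.+1] hab.
exists p => // i ip.
exists (greedy_step_fun ((nth b (a :: p) i + nth b p i) / 2)) => t tin.
rewrite /greedy_step_fun; congr (germ_val _ _ (s _)).
apply: piece_const (tin) _ => [j jm|].
  by apply: pout => //; apply/mapP; exists j; rewrite ?mem_iota.
by have /andP[ut tv] := tin; rewrite !midf_lt ?(lt_trans ut tv).
Qed.

Lemma greedy_step_fun_germ j : (j <= m)%N ->
  germ_lim greedy_step_fun (s j) (x j).
Proof.
move=> jm; rewrite /germ_lim; case s2: (s j).2; last first.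
  by rewrite /greedy_step_fun piece_germ ?s2.
apply/cvg_at_right_mdistP => e e0.
have [w sw pw] := piece_germ_right slt jm s2; exists w => // t st tw.
by rewrite /greedy_step_fun pw// mdistxx.
Qed.

Lemma total_variation_ge_germs (g : R -> E) :
  (forall j, (j <= m)%N -> germ_lim g (s j) (x j)) ->
  (length%:E <= total_variation a b g)%E.
Proof.
move=> /(truncated_variation_ge_germs 0 sin slt); apply: le_trans.
rewrite lee_fin; apply: ler_sum => i _; by rewrite subr0 le_max lexx.
Qed.

(** The values [x j] are taken at increasing germs, which gives the lower bound; between them the
    function is constant, which gives the upper one. *)
Lemma total_variation_greedy_step_fun :
  total_variation a b greedy_step_fun = length%:E.
Proof.
apply/eqP; rewrite eq_le; apply/andP; split; last first.
  exact: total_variation_ge_germs greedy_step_fun_germ.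
apply: (@total_variation_le_path _ _ _ _ _ (fun j => x j) piece (fun=> 0)).
- exact: ltW.
- exact: piece_le.
- by move=> t t'; exact: piece_mono.
- by move=> t _; rewrite mdistxx.
- by move=> t _ _; rewrite subr0 metric_sym.
- by [].
- by move=> t t' _ _ _ e; rewrite /greedy_step_fun e mdistxx subrr.
Qed.

Lemma total_variation_greedy_step_fun_le (lambda : R) : 1 < lambda ->
  (total_variation a b greedy_step_fun <= lambda%:E *
   truncated_variation ((lambda - 1) * c / (2 * lambda)) a b f)%E.
Proof.
move=> l1; have l0 : 0 < lambda by lra.
set delta := _ / _.
rewrite total_variation_greedy_step_fun.
(* [f] has the same values [x j] at these germs, so its truncated variation dominates the sum of the
   truncated jumps. *)
have := truncated_variation_ge_germs delta sin slt
  (fun j jm => germ_val_lim hr (sin jm)).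
move=> h; have l0' : (0 <= lambda%:E)%E by rewrite lee_fin ltW.
apply: le_trans (lee_wpmul2l l0' h).
rewrite -EFinM lee_fin mulr_sumr big_nat [leRHS]big_nat.
apply: ler_sum => -[//|i] /andP[_ im] /=.
have [_ _ d2 _ _] := snext im; rewrite (metric_sym (x i.+1)).
set d := mdist _ _ in d2 *.
apply: (@le_trans _ _ (lambda * (d - delta))).
  (* Thus [lambda * (d - delta) - d] equals [(lambda - 1) * (d - c / 2)], nonnegative because each
     jump is at least [c / 2]. *)
  have -> : lambda * (d - delta) = lambda * d - (lambda - 1) * (c / 2).
    by rewrite /delta; field; lra.
  have : 0 <= (lambda - 1) * (d - c / 2) by rewrite mulr_ge0; lra.
  lra.
by rewrite ler_pM2l// le_max lexx.
Qed.

(** * Affine interpolation in a normed space *)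

Section linear.
Context (nE : NormedModule R E).
Let V : normedModType R := NormedModule.Pack nE.
Hypothesis hV : forall y z : V, mdist (y : E) (z : E) = `|y - z|.

Local Notation xV j := (x j : V).

(* On a piece ending at a jump of [f] the step function is kept. *)
Definition slope (k : nat) : V :=
  if (k < m)%N && ~~ `[< jump a b f (s k.+1).1 >]
  then ((s k.+1).1 - (s k).1)^-1 *: (xV k.+1 - xV k) else 0.

Definition greedy_linear_fun (t : R) : V :=
  xV (piece t) + (t - (s (piece t)).1) *: slope (piece t).

Local Notation offset t := ((t - (s (piece t)).1) * `|slope (piece t)|).

Variant slope_spec (k : nat) : Prop :=
| SlopeZero of slope k = 0
| SlopeInterpolate of (k < m)%N & (s k).1 < (s k.+1).1 & (s k.+1).2
  & mdist (x k) (x k.+1) <= c / 2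
  & slope k = ((s k.+1).1 - (s k).1)^-1 *: (xV k.+1 - xV k).

(** The data of the interpolating case come from the clause of [greedy_next] about germs where [f]
    does not jump. *)
Lemma slopeP k : slope_spec k.
Proof.
case e: ((k < m)%N && ~~ `[< jump a b f (s k.+1).1 >]); last first.
  by apply: SlopeZero; rewrite /slope e.
have /andP[km /asboolPn nj] := e.
have [_ _ _ _ /(_ nj)[? ? ?]] := snext km.
by apply: SlopeInterpolate => //; rewrite /slope e.
Qed.

Lemma piece_fst_le t : a <= t -> (s (piece t)).1 <= t.
Proof.
move=> /(piece_germ_le m s0); rewrite /germ_le_pt.
by case: (s _).2 => // /ltW.
Qed.

Lemma mdist_linear_start t : a <= t ->
  mdist (x (piece t)) (greedy_linear_fun t : E) = offset t.
Proof.
move=> at_; rewrite hV /greedy_linear_fun opprD addrA subrr sub0r normrN normrZ.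
by rewrite ger0_norm// subr_ge0 piece_fst_le.
Qed.

(** On a straight segment the distances to the two ends add up to its length; with zero slope the
    offset vanishes. *)
Lemma mdist_linear_end t : a <= t -> (piece t < m)%N ->
  mdist (greedy_linear_fun t : E) (x (piece t).+1) <=
  mdist (x (piece t).+1) (x (piece t)) - offset t.
Proof.
move=> at_ km; have := piece_fst_le at_; have := piece_ltN km.
rewrite !hV /greedy_linear_fun; set k := piece t.
have [->|_ sk s2 _ ->] := slopeP k.
  by rewrite scaler0 normr0 mulr0 addr0 subr0 distrC.
(* As the next germ is a right germ, the piece includes its base point, and [u / d] runs up to 1. *)
rewrite /germ_le_pt s2 -leNgt => tk kt.
set d := (s k.+1).1 - (s k).1; have d0 : 0 < d by rewrite subr_gt0.
set u := t - (s k).1.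
have ud : 0 <= u <= d by rewrite subr_ge0 kt lerD2r.
rewrite normrZ scalerA mulrA ger0_norm ?invr_ge0 ?(ltW d0)//.
set v := _ - xV k.
have -> : xV k + (u / d) *: v - xV k.+1 = - ((1 - u / d) *: v).
  by rewrite scalerBl scale1r opprB /v addrAC addrC opprB.
have ud1 : 0 <= 1 - u / d.
  by rewrite subr_ge0 ler_pdivrMr// mul1r; case/andP: ud.
by rewrite normrN normrZ ger0_norm// [leLHS]mulrBl mul1r.
Qed.

Lemma mdist_linear_same t t' : t <= t' -> piece t = piece t' ->
  mdist (greedy_linear_fun t' : E) (greedy_linear_fun t : E) <=
  offset t' - offset t.
Proof.
move=> tt' e; rewrite hV /greedy_linear_fun e -mulrBl opprD addrACA subrr add0r.
rewrite -scalerBl normrZ opprB addrA subrK ger0_norm ?subr_ge0//.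
Qed.

Lemma affineE k (t : R) : xV k + (t - (s k).1) *: slope k =
  (xV k - (s k).1 *: slope k) + t *: slope k.
Proof. by rewrite scalerBl addrAC addrA. Qed.

Lemma greedy_linear_fun_linear : piecewise_linear a b greedy_linear_fun.
Proof.
have [p part pout] := itv_partition_avoiding [seq (s j).1 | j <- iota 0 m.+1] hab.
exists p => // i ip.
pose k := piece ((nth b (a :: p) i + nth b p i) / 2).
exists (xV k - (s k).1 *: slope k), (slope k) => t tin.
have -> : k = piece t.
  apply: (piece_const _ _ tin) => [j jm|].
    by apply: pout => //; apply/mapP; exists j; rewrite ?mem_iota.
  by have /andP[ut tv] := tin; rewrite !midf_lt ?(lt_trans ut tv).
exact: affineE.
Qed.

Lemma normr_sub_linear_le t : a <= t <= b ->
  `|(f t : V) - greedy_linear_fun t| <= c.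
Proof.
move=> tab; have /andP[at_ tb] := tab.
rewrite -hV; apply: le_trans (metric_triangle _ (x (piece t)) _) _.
rewrite (metric_sym (f t)) mdist_linear_start//.
have := mdist_piece_le tab.
(* The offset never exceeds the length of the segment, which is at most [c / 2] when the piece is
   interpolated. *)
suff : offset t <= c / 2 by lra.
have [->|km sk s2 d2 _] := slopeP (piece t).
  by rewrite normr0 mulr0 divr_ge0 ?ltW.
have := mdist_linear_end at_ km; rewrite (metric_sym (x (piece t).+1)).
have := mdist_ge0 (greedy_linear_fun t : E) (x (piece t).+1); lra.
Qed.

Lemma affine_near (u w : V) (t e : R) : 0 < e ->
  exists2 h, 0 < h & forall y, `|t - y| < h ->
    mdist (u + t *: w : E) (u + y *: w : E) < e.
Proof.
move=> e0; have n0 : 0 < `|w| + 1 by rewrite ltr_wpDl.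
exists (e / (`|w| + 1)) => [|y ty]; first by rewrite divr_gt0.
rewrite hV opprD addrACA subrr add0r -scalerBl normrZ.
move: ty; rewrite ltr_pdivlMr//; apply: le_lt_trans.
by rewrite ler_wpM2l// lerDl.
Qed.

Lemma linear_fun_at_right t w k (y : V) : t < w ->
  (forall u, t < u -> u < w -> piece u = k) ->
  xV k + (t - (s k).1) *: slope k = y ->
  (greedy_linear_fun : R -> E) u @[u --> t^'+] --> (y : E).
Proof.
move=> tw pw <-; apply/cvg_at_right_mdistP => d d0.
have [h h0 near_t] := affine_near (xV k - (s k).1 *: slope k) (slope k) t d0.
exists (Num.min w (t + h)) => [|u tu]; first by rewrite lt_min tw ltrDl.
rewrite lt_min => /andP[uw uh]; rewrite /greedy_linear_fun pw// !affineE.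
by apply: near_t; rewrite ltr0_norm; lra.
Qed.

Lemma linear_fun_at_left t w k (y : V) : w < t ->
  (forall u, w < u -> u < t -> piece u = k) ->
  xV k + (t - (s k).1) *: slope k = y ->
  (greedy_linear_fun : R -> E) u @[u --> t^'-] --> (y : E).
Proof.
move=> wt pw <-; apply/cvg_at_left_mdistP => d d0.
have [h h0 near_t] := affine_near (xV k - (s k).1 *: slope k) (slope k) t d0.
exists (Num.max w (t - h)) => [|u]; first by rewrite gt_max wt gtrBl.
rewrite gt_max => /andP[wu hu] ut; rewrite /greedy_linear_fun pw// !affineE.
by apply: near_t; rewrite gtr0_norm; lra.
Qed.

Lemma greedy_linear_fun_germ j : (j <= m)%N ->
  germ_lim (greedy_linear_fun : R -> E) (s j) (x j).
Proof.
move=> jm; rewrite /germ_lim; case s2: (s j).2; last first.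
  by rewrite /greedy_linear_fun piece_germ ?s2// subrr scale0r addr0.
have [w sw pw] := piece_germ_right slt jm s2.
by apply: (linear_fun_at_right sw pw); rewrite subrr scale0r addr0.
Qed.

(** Replacing a jump by the straight segment between the same two values leaves the length of the
    path unchanged. *)
Lemma total_variation_greedy_linear_fun :
  total_variation a b (greedy_linear_fun : R -> E) =
  total_variation a b greedy_step_fun.
Proof.
rewrite total_variation_greedy_step_fun.
apply/eqP; rewrite eq_le; apply/andP; split; last first.
  exact: total_variation_ge_germs greedy_linear_fun_germ.
apply: (@total_variation_le_path _ _ _ _ _ (fun j => x j) piece
  (fun t => offset t)).
- exact: ltW.
- exact: piece_le.
- by move=> t t'; exact: piece_mono.
- by move=> t /andP[at_ _]; rewrite mdist_linear_start.
- by move=> t /andP[at_ _]; exact: mdist_linear_end.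
(* The last piece has no successor to interpolate to, so its slope is zero. *)
- by move=> t _ e; rewrite /slope e ltnn/= normr0 mulr0 lexx.
- by move=> t t' _ tt' _; exact: mdist_linear_same.
Qed.

(** Inside a piece the function is affine. Where a new piece begins at [t] and [f] does not jump, it
    begins at the right germ, and the preceding segment has just reached the new value. *)
Lemma jump_greedy_linear_fun t :
  jump a b (greedy_linear_fun : R -> E) t -> jump a b f t.
Proof.
move=> lj; apply: contrapT => nj; case: lj => -[tab]; apply.
  have /andP[at_ _] := tab.
  have [[w tw pw]|[km sk]] := piece_right s0 slt at_.
    exact: (linear_fun_at_right tw pw).
  have := greedy_linear_fun_germ km; rewrite /germ_lim sk /= => lim.
  (* The point [t] still belongs to the old piece, whose segment ends there at the value of the next
     germ. *)
  suff e : greedy_linear_fun t = xV (piece t).+1 by rewrite e sk; exact: lim.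
  have njk : ~ jump a b f (s (piece t).+1).1 by rewrite sk.
  have [_ _ _ _ /(_ njk)[lts _ _]] := snext km.
  rewrite /greedy_linear_fun /slope km; move/asboolPn: njk => -> /=.
  rewrite scalerA sk /= divff ?scale1r; first by rewrite addrC subrK.
  by move: lts; rewrite sk/= subr_eq0 => /gt_eqF ->.
have /andP[at_ _] := tab.
have [[w tw pw]|[k0 sk]] := piece_left s0 slt at_.
  exact: (linear_fun_at_left tw pw).
have km : ((piece t).-1 < m)%N by rewrite prednK// piece_le.
(* A piece opening at the point [t] itself forces a jump of [f], since otherwise its germ would be a
   right germ. *)
have [_ _ _ _] := snext km; rewrite prednK// sk /= => /(_ nj)[].
by [].
Qed.

End linear.
End approximation.

(** * Lower bound over the ball around [f] *)

Section sup_ball.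
Context {R : realType} {E : metricType R} (a b c : R) (f : R -> E).

(** Each end of an increment moves by at most [c / 2] between [f] and [g], and the truncation
    absorbs the total change [c]. *)
Lemma truncated_variation_le_sup_ball (g : R -> E) :
  0 <= c -> sup_ball a b f (c / 2) g ->
  (truncated_variation c a b f <= total_variation a b g)%E.
Proof.
move=> c0 gball; have fg t : a <= t <= b -> mdist (f t) (g t) <= c / 2.
  move=> tab; rewrite -lee_fin; apply: le_trans gball; apply: ereal_sup_ubound.
  by exists t => //=; rewrite in_itv.
apply: ge_ereal_sup => _ [n [t [at0 tlt tnb ->]]].
have tin := points_in_itv at0 tlt tnb.
apply: (@le_trans _ _ (\sum_(1 <= i < n.+1)
    Num.max (mdist (g (t i)) (g (t i.-1)) - 0) 0)%:E); last first.
  by apply: ereal_sup_ubound; exists n, t; split.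
rewrite lee_fin big_nat [leRHS]big_nat; apply: ler_sum => i /andP[_ im].
have h1 := fg _ (tin i im).
have h2 := fg _ (tin i.-1 (leq_trans (leq_pred i) (im : (i <= n)%N))).
rewrite subr0 (max_l (mdist_ge0 _ _)) ge_max mdist_ge0 andbT.
have := metric_triangle (f (t i)) (g (t i)) (f (t i.-1)).
have := metric_triangle (g (t i)) (g (t i.-1)) (f (t i.-1)).
rewrite (metric_sym (g (t i.-1))); lra.
Qed.

End sup_ball.

Theorem theorem1 (R : realType) (E : metricType R) (a b c : R) (f : R -> E)
    (hab : a < b) (hc : 0 < c) (hf : regulated a b f) :
  [/\ exists fc : R -> E,
        [/\ step_function a b fc,
            (sup_dist a b f fc <= (c / 2)%:E)%E,
            forall lambda : R, 1 < lambda ->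
              (total_variation a b fc <=
               lambda%:E * truncated_variation
                             ((lambda - 1) * c / (2 * lambda)) a b f)%E &
            (* E carries a normed space structure V inducing its metric *)
            forall (nE : NormedModule R E)
                   (V := NormedModule.Pack nE : normedModType R),
              (forall x y : V, mdist (x : E) (y : E) = `|x - y|) ->
              exists flin : R -> V,
                [/\ piecewise_linear a b flin,
                    forall t : R, jump a b (flin : R -> E) t -> jump a b f t,
                    (ereal_sup [set `|(f t : V) - flin t|%:E
                               | t in `[a, b]%classic] <= c%:E)%E &
                    total_variation a b (flin : R -> E) =
                    total_variation a b fc]],
      ((truncated_variation c a b f <=
        ereal_inf [set total_variation a b g | g in sup_ball a b f (c / 2)])%E /\
       (ereal_inf [set total_variation a b g | g in sup_ball a b f (c / 2)] <=
        ereal_inf [set lambda%:E * truncated_variation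
                         ((lambda - 1) * c / (2 * lambda)) a b f
                  | lambda in [set lambda : R | (1 < lambda)%R]])%E) &
      ((truncated_variation c a b f <=
        ereal_inf [set total_variation a b g | g in sup_ball a b f (c / 2)])%E /\
       (ereal_inf [set total_variation a b g | g in sup_ball a b f (c / 2)] <=
        2%:E * truncated_variation (c / 4) a b f)%E)].
Proof.
have [hright hleft] := hf.
have /choice[r hr] : forall t, exists l : E,
    a <= t < b -> f x @[x --> t^'+] --> l.
  move=> t; have [/hright[l fl]|] := boolP (a <= t < b); first by exists l.
  (* Outside [a, b) the value of [r] is arbitrary. *)
  by exists (f t).
have [s [m [s0 sin snext send]]] := greedy_chain hc hr hleft hab.
pose fc := greedy_step_fun f r s m.
have fc_dist : (sup_dist a b f fc <= (c / 2)%:E)%E.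
  apply: ge_ereal_sup => _ [t /= tab <-].
  rewrite lee_fin metric_sym; apply: (mdist_piece_le s0 snext send).
  by move: tab; rewrite in_itv.
have fc_le lambda : 1 < lambda -> (total_variation a b fc <=
    lambda%:E * truncated_variation ((lambda - 1) * c / (2 * lambda)) a b f)%E.
  exact: total_variation_greedy_step_fun_le.
have lower : (truncated_variation c a b f <=
    ereal_inf [set total_variation a b g | g in sup_ball a b f (c / 2)])%E.
  apply: le_ereal_inf_tmp => _ [g gball <-].
  exact: truncated_variation_le_sup_ball (ltW hc) gball.
have upper lambda : 1 < lambda ->
    (ereal_inf [set total_variation a b g | g in sup_ball a b f (c / 2)] <=
    lambda%:E * truncated_variation ((lambda - 1) * c / (2 * lambda)) a b f)%E.
  by move=> /fc_le; apply: le_trans; apply: ereal_inf_lbound; exists fc.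
split.
- exists fc; split=> //; first exact: greedy_step_fun_step.
  move=> nE V hV; exists (greedy_linear_fun a b f r s m nE); split.
  + exact: greedy_linear_fun_linear.
  + exact: (jump_greedy_linear_fun s0 snext hV).
  + apply: ge_ereal_sup => _ [t /= tab <-]; rewrite lee_fin.
    apply: (normr_sub_linear_le hc s0 snext send hV).
    by move: tab; rewrite in_itv.
  + exact: (total_variation_greedy_linear_fun hab s0 sin snext hV).
- by split=> //; apply: le_ereal_inf_tmp => _ [lambda /= /upper h <-].
- split=> //; rewrite (_ : c / 4 = (2 - 1) * c / (2 * 2)); last by field.
  by apply: upper; rewrite ltr1n.
Qed.
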